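(* Let $G$ be a finitely generated nilpotent group and let $M \subseteq G$ be a submonoid of $G$ such that $MG' = G$, where $MG' = \{mg \mid m \in M,\ g \in G'\}$. Then $M = G$.
   Context: $G' = [G,G]$ denotes the commutator subgroup of $G$. A submonoid of $G$ is a subset containing the identity $e_G$ and closed under multiplication; it is not assumed to be closed under inverses. *)

(* Defs.v *)
From mathcomp Require Import all_boot.
From mathcomp Require Import boolp classical_sets cardinality.

Set Implicit Arguments.
Unset Strict Implicit.
Unset Printing Implicit Defensive.

Local Open Scope group_scope.
Local Open Scope classical_set_scope.

(* Subsets of a group [G] are Prop-valued, of type [set G]; [[in A]] views such
   a set as a collective predicate, so that the closure predicates of the
   library apply to it. *)
Definition submonoid (G : groupType) (M : set G) : Prop :=
  monoid_closed [in M].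

Definition subgroup (G : groupType) (H : set G) : Prop :=
  group_closed [in H].

Definition generated (G : groupType) (A : set G) : set G :=
  smallest (@subgroup G) A.

Definition finitely_generated (G : groupType) : Prop :=
  exists2 A : set G, finite_set A & generated A = [set: G].

Definition commutator_subgroup (G : groupType) (A B : set G) : set G :=
  generated [set [~ x, y] | x in A & y in B].

Definition derived_subgroup (G : groupType) : set G :=
  commutator_subgroup [set: G] [set: G].

Arguments derived_subgroup G : clear implicits.

(* The indexing starts at 0, with [lower_central G 0] the whole group. *)
Fixpoint lower_central (G : groupType) (n : nat) : set G :=
  if n is n'.+1 then commutator_subgroup (lower_central n') [set: G]
  else [set: G].

Arguments lower_central G n : clear implicits.

Definition nilpotent_group (G : groupType) : Prop :=
  exists n : nat, lower_central G n = [set 1].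

Definition set_mul (G : groupType) (A B : set G) : set G :=
  [set a * b | a in A & b in B].

(* Main.v *)
(** By induction on [n], [M * lower_central G n.+1 = G]; nilpotency then gives
    the claim.  For the inductive step, pass to the quotient by
    [lower_central G n.+2]: there the image [C] of [lower_central G n.+1] is
    central, generated by finitely many commutators, and [M C] is everything.

    Let [c = [~ x, y]] be a central commutator.  Modulo [C], each of [x^-1],
    [x], [y^-1], [y] lies in [M]; multiplying the [k]-th powers of the four
    representatives in [M] gives [c ^+ (k ^ 2) * w ^+ k] in [M] for all [k],
    where [w] in [M] and [C] depends only on [x] and [y].  As [C] is finitely
    generated one [w] serves for all generators and their inverses.  Writing
    [w^-1] as a product of [a] of these, one gets
    [w ^- (k ^ 2) * w ^+ (a * k)] in [M]; the quadratic term wins, so [w^-1]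
    is in [M], and [k = 1] puts every generator of [C] in [M]. *)
From HB Require Import structures.
Require Import Defs.
From mathcomp Require Import all_boot generic_quotient.
From mathcomp Require Import boolp classical_sets cardinality.

Set Implicit Arguments.
Unset Strict Implicit.
Unset Printing Implicit Defensive.

Local Open Scope group_scope.
Local Open Scope classical_set_scope.
Local Open Scope quotient_scope.

(** * Closure properties of submonoids and subgroups *)

Section Closure.
Variable G : groupType.
Implicit Types (H A : set G) (x y : G).

Lemma submonoidP H :
  submonoid H <-> H 1 /\ forall x y, H x -> H y -> H (x * y).
Proof.
split=> [[H1 HM]|[H1 HM]].
  by split=> [|x y Hx Hy]; [exact/set_mem|apply/set_mem/HM; exact/mem_set].
by split=> [|x y Hx Hy]; apply/mem_set => //; apply: HM; exact/set_mem.
Qed.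

Lemma subgroupP H :
  subgroup H <-> H 1 /\ forall x y, H x -> H y -> H (x / y).
Proof.
split=> [[H1 HM]|[H1 HM]].
  by split=> [|x y Hx Hy]; [exact/set_mem|apply/set_mem/HM; exact/mem_set].
by split=> [|x y Hx Hy]; apply/mem_set => //; apply: HM; exact/set_mem.
Qed.

Lemma subgroup1 H : subgroup H -> H 1.
Proof. by case/subgroupP. Qed.

Lemma subgroupF H x y : subgroup H -> H x -> H y -> H (x / y).
Proof. by move=> /subgroupP[_ HF]; exact: HF. Qed.

Lemma subgroupV H x : subgroup H -> H x -> H x^-1.
Proof.
by move=> sH Hx; rewrite -div1g; apply: subgroupF => //; exact: subgroup1.
Qed.

Lemma subgroupM H x y : subgroup H -> H x -> H y -> H (x * y).
Proof.
move=> sH Hx Hy; rewrite -[y]invgK.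
by apply: subgroupF => //; exact: subgroupV.
Qed.

Lemma submonoidX H x k : submonoid H -> H x -> H (x ^+ k).
Proof.
move=> /submonoidP[H1 HM] Hx; elim: k => [//|k IHk].
by rewrite expgS; exact: HM.
Qed.

Lemma subgroup_generated A : subgroup (generated A).
Proof.
apply/subgroupP; split=> [|x y Ax Ay] K /= [sK AK]; first exact: subgroup1.
by apply: subgroupF => //; [apply: Ax|apply: Ay].
Qed.

Lemma subgroup_center : subgroup [set x : G | forall g, commute x g].
Proof.
apply/subgroupP; split=> [g|x y cx cy g] /=.
  exact/commute_sym/commute1.
apply/commute_sym/commuteM; first exact/commute_sym.
exact/commuteV/commute_sym.
Qed.

End Closure.

(** * Submonoids that fill the group up to central commutators *)

Section CentralCommutators.
Variable G : groupType.
Implicit Types (M A : set G) (x y c : G).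

(** Conjugation by [y] multiplies [x] by the central element [[~ x, y]], so conjugation by [y ^+ k]
    multiplies it by the [k]-th power; raising [x] to the power [k] contributes the second factor
    [k]. *)
Lemma commXX_central x y k : (forall g, commute [~ x, y] g) ->
  [~ x ^+ k, y ^+ k] = [~ x, y] ^+ (k * k).
Proof.
move=> cc.
have xJy : x ^ y = x * [~ x, y] by rewrite commgEl mulVKg.
have xJyk j : x ^ (y ^+ j) = x * [~ x, y] ^+ j.
  elim: j => [|j IHj]; first by rewrite conjg1 mulg1.
  rewrite expgSr conjgM IHj conjMg xJy conjXg.
  have -> : [~ x, y] ^ y = [~ x, y].
    by apply/conjg_fixP/commgP.
  by rewrite -mulgA -expgS.
rewrite commgEl conjXg xJyk expgMn ?mulKg ?expgnA //.
exact/commuteX/commute_sym.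
Qed.

Lemma mulgACA_commute x a y b :
  commute a y -> (x * a) * (y * b) = (x * y) * (a * b).
Proof. by move=> ay; rewrite -mulgA (mulgA a) ay -!mulgA. Qed.

(** A correction growing linearly in [k] pays for a quadratic power of [c]; this gap in growth is
    what is exploited later. *)
Definition quad_absorbed M c w := forall k, M (c ^+ (k * k) * w ^+ k).

Lemma central_comm_absorbed M A x y : submonoid M -> subgroup A ->
    (forall a, A a -> forall g, commute a g) -> set_mul M A = [set: G] ->
    (forall g, commute [~ x, y] g) ->
  exists w, [/\ M w, A w & quad_absorbed M [~ x, y] w].
Proof.
move=> sM sA cA MA cc.
have lift g : exists2 a, A a & M (g * a).
  have : set_mul M A g by rewrite MA.
  case=> m Mm [a Aa <-]; exists a^-1; first exact: subgroupV.
  by rewrite mulgK.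
have [a Aa Ma] := lift x^-1; have [b Ab Mb] := lift y^-1.
have [a' Aa' Ma'] := lift x; have [b' Ab' Mb'] := lift y.
have [_ MM] := (submonoidP M).1 sM.
(* The same four elements of [M] are multiplied in two orders: [x^-1, x, y^-1, y] cancels down to
   [w] itself, while [k]-th powers in the order [x^-1, y^-1, x, y] produce [[~ x ^+ k, y ^+ k]]
   times [w ^+ k]. *)
exists (a * b * (a' * b')); split.
- suff -> : a * b * (a' * b') = (x^-1 * a) * (x * a') * ((y^-1 * b) * (y * b')).
    by apply: (MM); apply: (MM).
  rewrite (mulgACA_commute _ _ (cA a Aa x)) (mulgACA_commute _ _ (cA b Ab y)).
  by rewrite !mulVg !mul1g; apply: mulgACA_commute; exact: cA.
- by do 2!apply: subgroupM => //; apply: subgroupM.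
move=> k.
suff -> : [~ x, y] ^+ (k * k) * (a * b * (a' * b')) ^+ k =
    ((x^-1 * a) ^+ k * (y^-1 * b) ^+ k) * ((x * a') ^+ k * (y * b') ^+ k).
  by apply: (MM); apply: (MM); exact: submonoidX.
have cX u v : A u -> commute (u ^+ k) v.
  by move=> Au; apply/commute_sym/commuteX/commute_sym/cA.
rewrite -commXX_central // !expgMn; try by [exact: cA|exact/commute_sym/cA].
  rewrite (mulgACA_commute (x^-1 ^+ k)); last exact: cX.
  rewrite (mulgACA_commute (x ^+ k)); last exact: cX.
  rewrite [RHS]mulgACA_commute ?expVgn /commg /conjg ?mulgA //.
  by rewrite -expgMn; [apply/cX; exact: subgroupM | exact: cA].
by apply: cA; exact: subgroupM.
Qed.

Lemma quad_absorbedM M c w v : submonoid M -> commute w v -> M v ->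
  quad_absorbed M c w -> quad_absorbed M c (w * v).
Proof.
move=> sM cwv Mv absw k; rewrite expgMn // mulgA.
by apply: ((submonoidP M).1 sM).2 => //; exact: submonoidX.
Qed.

Lemma finite_central_comm_absorbed M A X : submonoid M -> subgroup A ->
    (forall a, A a -> forall g, commute a g) -> set_mul M A = [set: G] ->
    finite_set X -> X `<=` A ->
    (forall c, X c -> exists x y, c = [~ x, y]) ->
  exists w, [/\ M w, A w & forall c, X c ->
    quad_absorbed M c w /\ quad_absorbed M c^-1 w].
Proof.
move=> sM sA cA MA /finite_seqP[s ->] {X} sXA comm_s.
have [M1 MM] := (submonoidP M).1 sM.
elim: s sXA comm_s => [|c s IHs] sXA comm_s.
  by exists 1; split=> //; exact: subgroup1.
have [||w [Mw Aw absw]] := IHs.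
- by move=> d /= sd; apply: sXA; rewrite /= inE sd orbT.
- by move=> d /= sd; apply: comm_s; rewrite /= inE sd orbT.
have Ac : A c by apply: sXA; rewrite /= mem_head.
have [x [y cxy]] : exists x y, c = [~ x, y].
  by apply: comm_s; rewrite /= mem_head.
have [|u [Mu Au absu]] := @central_comm_absorbed M A x y sM sA cA MA.
  by rewrite -cxy; exact: cA.
(* Swapping [x] and [y] inverts the commutator, which handles [c^-1]. *)
have [|v [Mv Av absv]] := @central_comm_absorbed M A y x sM sA cA MA.
  by rewrite -invgR -cxy; apply: cA; exact: subgroupV.
rewrite -cxy in absu; rewrite -invgR -cxy in absv.
exists (u * v * w); split=> [||d].
- by apply: (MM) => //; exact: MM.
- by apply: subgroupM => //; exact: subgroupM.
rewrite /= inE => /orP[/eqP->|/absw[absw1 absw2]].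
  have cuv : commute (u * v) w by apply: cA; exact: subgroupM.
  split; apply: quad_absorbedM => //.
    by apply: quad_absorbedM => //; exact: cA.
  by rewrite (cA u Au v); apply: quad_absorbedM => //; exact: cA.
have -> : u * v * w = w * (u * v) by apply/commute_sym/cA.
by split; apply: quad_absorbedM => //; by [exact: cA|exact: MM].
Qed.

Lemma submonoid_central_comm M X : submonoid M -> finite_set X ->
    (forall c, X c -> forall g, commute c g) ->
    (forall c, X c -> exists x y, c = [~ x, y]) ->
  set_mul M (generated X) = [set: G] -> M = [set: G].
Proof.
move=> sM finX cX commX MA; have sA := subgroup_generated X.
set A := generated X in MA sA.
have XA : X `<=` A by exact: sub_gen_smallest.
have cA a : A a -> forall g, commute a g.
  by move=> Aa; exact: (Aa _ (conj (@subgroup_center G) cX)).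
have [w [Mw Aw absw]] := finite_central_comm_absorbed sM sA cA MA finX XA commX.
have [M1 MM] := (submonoidP M).1 sM.
pose P c := exists a, quad_absorbed M c (w ^+ a).
have PM c d : A c -> P c -> P d -> P (c * d).
  move=> Ac [a Pa] [b Pb]; exists (a + b)%N => k.
  have cwa : commute (w ^+ a) (w ^+ b) by apply: commuteX2; exact: commute_refl.
  rewrite expgnDr (expgMn _ (cA c Ac d)) (expgMn _ cwa) mulgACA_commute.
    exact: MM.
  by apply/commuteX/commuteX2/commute_sym/cA.
(* [PM] only gives closure under products; carrying [c^-1] along yields a subgroup, to which the
   minimality of [A] applies. *)
have sAP : subgroup [set c | [/\ A c, P c & P c^-1]].
  apply/subgroupP; split=> /= [|c d [Ac Pc Pc'] [Ad Pd Pd']].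
    split; first exact: subgroup1.
      by exists 0%N => k; rewrite !expg1n mulg1.
    by exists 0%N => k; rewrite invg1 !expg1n mulg1.
  rewrite invgF; split; first exact: (subgroupF sA Ac Ad).
    by apply: PM.
  by apply: PM.
have AP c : A c -> P c.
  suff : A `<=` [set c | [/\ A c, P c & P c^-1]] by move=> /[apply] -[].
  apply: smallest_sub => // d Xd /=; split; first exact: XA.
    by exists 1%N => k; exact: (absw d Xd).1.
  by exists 1%N => k; exact: (absw d Xd).2.
have MwV : M w^-1.
  have [a Pa] := AP _ (subgroupV sA Aw).
  (* Taking [k = a.+1] in [Pa] gives exponent [-(a+1)^2 + a(a+1) = -(a+1)]; the last factor [w ^+ a]
     raises it to [-1]. *)
  suff -> : w^-1 = w^-1 ^+ (a.+1 * a.+1) * w ^+ a ^+ a.+1 * w ^+ a.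
    by apply: (MM) => //; exact: submonoidX.
  have -> : (a.+1 * a.+1)%N = (a * a.+1 + a).+1 by rewrite mulSn addSn addnC.
  by rewrite -expgnA -mulgA -expgnDr expgS -mulgA expVgn mulVg mulg1.
apply/seteqP; split=> // x _.
have : set_mul M A x by rewrite MA.
case=> m Mm [c Ac <-]; apply: (MM) => //.
have [a Pa] := AP c Ac.
have -> : c = c ^+ (1 * 1) * w ^+ a ^+ 1 * w^-1 ^+ a.
  by rewrite expVgn !expg1 mulgK.
by apply: (MM); [exact: Pa|exact: submonoidX].
Qed.
End CentralCommutators.

(** * Lower central series: normality and finite generation of its factors *)

Section LowerCentral.
Variable G : groupType.
Implicit Types (A X : set G) (x y g : G) (n : nat).

Lemma subgroup_lower_central n : subgroup (lower_central G n).
Proof. by case: n => [|n]; [exact/subgroupP|exact: subgroup_generated]. Qed.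

Lemma lower_central_comm n x g :
  lower_central G n x -> lower_central G n.+1 [~ x, g].
Proof. by move=> nx; apply: sub_gen_smallest; exists x => //; exists g. Qed.

Lemma lower_centralJ n x g : lower_central G n x -> lower_central G n (x ^ g).
Proof.
elim: n x g => [//|n IHn] x g nx.
have sn := subgroup_lower_central n.+1.
(* Membership in a generated subgroup is tested on the subgroup of elements all of whose conjugates
   stay in the term; it contains the generators, as a conjugate of a commutator is the commutator of
   the conjugates. *)
suff : [set x | forall g, lower_central G n.+1 (x ^ g)] x by [].
apply: nx; split=> [|_ [y ny [z _ <-]] h] /=.
  apply/subgroupP; split=> [h|y z ny nz h] /=.
    by rewrite conj1g; exact: subgroup1.
  rewrite conjMg conjVg; apply: (subgroupF sn); [exact: ny|exact: nz].
by rewrite conjRg; apply: lower_central_comm; exact: IHn.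
Qed.

Lemma lower_centralS n : lower_central G n.+1 `<=` lower_central G n.
Proof.
have sn := subgroup_lower_central n.
apply: smallest_sub => // _ [x nx [y _ <-]]; apply: (subgroupM sn).
  exact: (subgroupV sn).
exact: lower_centralJ.
Qed.

Lemma commgFr x y z : [~ x, y / z] = ([~ x, z]^-1 * [~ x, y]) ^ z^-1.
Proof. by rewrite /commg /conjg ?gnorm. Qed.

Lemma commgFl x y z : [~ x / z, y] = ([~ x, y] / [~ z, y]) ^ z^-1.
Proof. by rewrite /commg /conjg ?gnorm. Qed.

(** Modulo [lower_central G n.+2] the commutator is multiplicative in each argument, so generators
    in both arguments suffice; first arguments from [lower_central G n.+1] vanish there. *)
Lemma lower_centralS_gen A X n : generated A = [set: G] ->
    X `<=` lower_central G n ->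
    lower_central G n `<=` generated (X `|` lower_central G n.+1) ->
  lower_central G n.+1 `<=`
    generated ([set [~ x, a] | x in X & a in A] `|` lower_central G n.+2).
Proof.
move=> genA Xn genX; set XA := [set _ | _ in _ & _ in _].
set Y := generated _.
have sY : subgroup Y by exact: subgroup_generated.
have XAY : XA `<=` Y by move=> c XAc; apply: sub_gen_smallest; left.
have nY : lower_central G n.+2 `<=` Y.
  by move=> c nc; apply: sub_gen_smallest; right.
have Yn : Y `<=` lower_central G n.+1.
  apply: smallest_sub; first exact: subgroup_lower_central.
  move=> c [[x Xx [a _ <-]]|]; last exact: lower_centralS.
  apply: lower_central_comm; exact: Xn.
(* Here [u ^ g = u * [~ u, g]], and the commutator falls into [lower_central G n.+2]. This absorbs
   the outer conjugations in [commgFr] and [commgFl]. *)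
have YJ u g : Y u -> Y (u ^ g).
  move=> Yu; rewrite -[u ^ g](mulVKg u); apply: (subgroupM sY) => //.
  exact: (nY _ (lower_central_comm g (Yn _ Yu))).
have Yr x : (forall a, A a -> Y [~ x, a]) -> forall y, Y [~ x, y].
  move=> YA y; have Ay : generated A y by rewrite genA.
  suff : [set y | Y [~ x, y]] y by [].
  apply: Ay; split=> // {y}; apply/subgroupP; split=> [|y z] /=.
    by rewrite commg1; exact: subgroup1.
  move=> Yy Yz; rewrite commgFr; apply: YJ.
  by apply: (subgroupM sY) => //; exact: (subgroupV sY).
apply: smallest_sub => // _ [x nx [y _ <-]].
suff : [set x | Y [~ x, y]] x by [].
apply: (genX x nx); split=> [|z [Xz|nz]].
- apply/subgroupP; split=> [|u v] /=; first by rewrite comm1g; exact: subgroup1.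
  by move=> Yu Yv; rewrite commgFl; apply: YJ; exact: (subgroupF sY).
- by apply: Yr => a Aa; apply: XAY; exists z => //; exists a.
- exact: (nY _ (lower_central_comm y nz)).
Qed.

Lemma lower_central_fin_gen n : finitely_generated G ->
  exists X, [/\ finite_set X, X `<=` lower_central G n &
    lower_central G n `<=` generated (X `|` lower_central G n.+1)].
Proof.
move=> [A finA genA]; elim: n => [|n [X [finX Xn genX]]].
  exists A; split=> //; rewrite /= -genA.
  apply: sub_smallest2r; first exact: subgroup_generated.
  by move=> x; left.
exists [set [~ x, a] | x in X & a in A]; split.
- exact: finite_image2.
- by move=> _ [x Xx [a _ <-]]; apply: lower_central_comm; exact: Xn.
- exact: lower_centralS_gen.
Qed.
End LowerCentral.

(** * Quotient of a group by a normal subgroup *)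

Section Quotient.
Variables (G : groupType) (N : set G) (sN : subgroup N).
Hypothesis nN : forall x g, N x -> N (x ^ g).

Definition eq_coset (x y : G) : bool := `[< N (x^-1 * y) >].

Lemma eq_coset_class : equiv_class_of eq_coset.
Proof.
split=> [x|x y|y x z].
- by apply/asboolP; rewrite mulVg; exact: subgroup1.
- suff sym u v : eq_coset u v -> eq_coset v u by apply/idP/idP; exact: sym.
  move=> /asboolP/(subgroupV sN) Nuv; apply/asboolP.
  by move: Nuv; rewrite invgM invgK.
- move=> /asboolP Nxy /asboolP Nyz; apply/asboolP.
  by have := subgroupM sN Nxy Nyz; rewrite -mulgA mulVKg.
Qed.

Canonical eq_coset_rel := EquivRelPack eq_coset_class.
Canonical eq_coset_encModRel := defaultEncModRel eq_coset.

Definition coset_group := {eq_quot eq_coset}.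
HB.instance Definition _ : EqQuotient G eq_coset coset_group :=
  EqQuotient.on coset_group.
HB.instance Definition _ := Choice.on coset_group.

Definition coset (x : G) : coset_group := \pi_coset_group x.

Lemma cosetP x y : coset x = coset y <-> N (x^-1 * y).
Proof.
by split=> [/eqmodP/asboolP//|Nxy]; apply/eqmodP/asboolP.
Qed.

Definition coset_mul (u v : coset_group) := coset (repr u * repr v).
Definition coset_inv (u : coset_group) := coset (repr u)^-1.

Lemma cosetK u : coset (repr u) = u.
Proof. exact: reprK. Qed.

Lemma coset_mulE x y : coset_mul (coset x) (coset y) = coset (x * y).
Proof.
have Nx : N ((repr (coset x))^-1 * x) by apply/cosetP; rewrite cosetK.
have Ny : N ((repr (coset y))^-1 * y) by apply/cosetP; rewrite cosetK.
apply/cosetP; move: (repr (coset x)) (repr (coset y)) Nx Ny => x' y' Nx Ny.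
have -> : (x' * y')^-1 * (x * y) = (x'^-1 * x) ^ y' * (y'^-1 * y).
  by rewrite /conjg ?gnorm.
by apply: (subgroupM sN) => //; exact: nN.
Qed.

Lemma coset_invE x : coset_inv (coset x) = coset x^-1.
Proof.
have Nx : N ((repr (coset x))^-1 * x) by apply/cosetP; rewrite cosetK.
apply/cosetP; rewrite invgK; move: (repr _) Nx => x' Nx.
have := subgroupV sN (nN x^-1 Nx).
by rewrite -conjVg /conjg ?gnorm.
Qed.

Lemma coset_mulA : associative coset_mul.
Proof.
by move=> u v w; rewrite -[u]cosetK -[v]cosetK -[w]cosetK !coset_mulE mulgA.
Qed.

Lemma coset_1mul : left_id (coset 1) coset_mul.
Proof. by move=> u; rewrite -[u]cosetK coset_mulE mul1g. Qed.

Lemma coset_mul1 : right_id (coset 1) coset_mul.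
Proof. by move=> u; rewrite -[u]cosetK coset_mulE mulg1. Qed.

Lemma coset_Vmul : left_inverse (coset 1) coset_inv coset_mul.
Proof. by move=> u; rewrite -[u]cosetK coset_invE coset_mulE mulVg. Qed.

Lemma coset_mulV : right_inverse (coset 1) coset_inv coset_mul.
Proof. by move=> u; rewrite -[u]cosetK coset_invE coset_mulE mulgV. Qed.

HB.instance Definition _ := isGroup.Build coset_group
  coset_mulA coset_1mul coset_mul1 coset_Vmul coset_mulV.

Lemma cosetF : {morph coset : x y / x / y}.
Proof. by move=> x y; rewrite -coset_mulE -coset_invE. Qed.

HB.instance Definition _ := isGroupMorphism.Build G coset_group coset cosetF.

(** Hides the chosen representatives: later arguments need only a surjective morphism with kernel
    [N]. *)
Lemma quotient_group :
  exists (H : groupType) (p : UMagmaMorphism.type G H),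
    (forall u, exists x, p x = u) /\ forall x y, p x = p y <-> N (x^-1 * y).
Proof.
exists coset_group, coset; split=> [u|x y]; last exact: cosetP.
by exists (repr u); exact: cosetK.
Qed.
End Quotient.

(** * Descent along the lower central series and conclusion *)

Lemma subgroup_preimage (G H : groupType) (p : UMagmaMorphism.type G H)
  (K : set H) : subgroup K -> subgroup (p @^-1` K).
Proof.
move=> sK; apply/subgroupP; split=> [|x y Kx Ky] /=.
  by rewrite gmulf1; exact: subgroup1.
by rewrite gmulfF; exact: (subgroupF sK).
Qed.

Lemma submonoid_image (G H : groupType) (p : UMagmaMorphism.type G H)
  (M : set G) : submonoid M -> submonoid (p @` M).
Proof.
move=> /submonoidP[M1 MM]; apply/submonoidP; split.
  by exists 1 => //; exact: gmulf1.
move=> _ _ [x Mx <-] [y My <-]; exists (x * y); first exact: MM.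
exact: gmulfM.
Qed.

Lemma submonoid_mul_lower_central (G : groupType) (M : set G) n :
    finitely_generated G -> submonoid M ->
    set_mul M (lower_central G 1) = [set: G] ->
  set_mul M (lower_central G n.+1) = [set: G].
Proof.
move=> fgG sM M1; elim: n => [//|n IHn].
have [X [finX Xn genX]] := lower_central_fin_gen n fgG.
have [A finA genA] := fgG.
have := lower_centralS_gen genA Xn genX.
set XA := [set _ | _ in _ & _ in _] => genXA.
have finXA : finite_set XA by exact: finite_image2.
have XAn : XA `<=` lower_central G n.+1.
  by move=> _ [x Xx [a _ <-]]; exact: (lower_central_comm a (Xn _ Xx)).
have sN := subgroup_lower_central G n.+2.
have [H [p [p_surj p_eq]]] := quotient_group sN (@lower_centralJ G n.+2).
have p1 : p 1 = 1 by exact: gmulf1.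
have pM : p @` M = [set: H].
  apply: (@submonoid_central_comm H _ (p @` XA)).
  - exact: submonoid_image.
  - exact: finite_image.
  - move=> _ [c XAc <-] u; have [g <-] := p_surj u.
    apply/commgP/eqP; rewrite -gmulfR -p1; apply/esym/p_eq.
    by rewrite invg1 mul1g; exact: (lower_central_comm g (XAn _ XAc)).
  - move=> _ [_ [x _ [a _ <-]] <-]; exists (p x), (p a); exact: gmulfR.
  apply/seteqP; split=> // u _; have [g <-] := p_surj u.
  have : set_mul M (lower_central G n.+1) g by rewrite IHn.
  case=> m Mm [c nc <-]; exists (p m); first by exists m.
  exists (p c); last by rewrite gmulfM.
  (* [XA] generates [lower_central G n.+1] only together with [lower_central G n.+2], which [p]
     kills. *)
  suff : (p @^-1` generated (p @` XA)) c by [].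
  apply: (genXA c nc); split=> [|d [XAd|Nd]] /=.
  - exact/subgroup_preimage/subgroup_generated.
  - by apply: sub_gen_smallest; exists d.
  - have -> : p d = 1.
      by rewrite -p1; apply/esym/p_eq; rewrite invg1 mul1g.
    exact: (subgroup1 (subgroup_generated _)).
apply/seteqP; split=> // g _; have : (p @` M) (p g) by rewrite pM.
case=> m Mm /p_eq Nmg; exists m => //.
by exists (m^-1 * g) => //; rewrite mulVKg.
Qed.

Theorem corollary1 (G : groupType) (M : set G) :
  finitely_generated G ->
  nilpotent_group G ->
  submonoid M ->
  set_mul M (derived_subgroup G) = [set: G] ->
  M = [set: G].
Proof.
move=> fgG [n nilG] sM MG'.
(* [derived_subgroup G] unfolds to [lower_central G 1]. The descent reaches index [n.+1], one past
   the trivial term, so [n = 0] needs no separate case. *)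
have := submonoid_mul_lower_central n fgG sM MG' => MN.
apply/seteqP; split=> // g _.
have : set_mul M (lower_central G n.+1) g by rewrite MN.
by case=> m Mm [c /lower_centralS]; rewrite nilG => -> <-; rewrite mulg1.
Qed.
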